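(* Let $(\mathcal{S}^x,H)$ be a finite thick skew translation generalized quadrangle of order $(s,t)$, where $s$ is odd if $s=t$, and suppose property ( * ) holds. Let $\mathbb{S}$ be its group of symmetries about $x$. Then: (i) for every line $L$ not incident with $x$, every element of the stabilizer $H_L$ fixes every line through the point $\mathrm{proj}_L x$; (ii) for every line $L$ not incident with $x$ and every nontrivial $\alpha\in H_L$, the set $[\alpha]$ of points of the line $x\,\mathrm{proj}_Lx$ that are incident with some line not through $x$ fixed by $\alpha$ has size $s/t$; in particular, if $s=t$ is odd, the lines not through $x$ fixed by $\alpha$ are precisely the $t$ lines through $\mathrm{proj}_Lx$ other than $x\,\mathrm{proj}_Lx$; (iii) $Z(H)=\mathbb{S}$.
   Context: A finite generalized quadrangle (GQ) of order $(s,t)$: every line has $s+1$ points, every point is on $t+1$ lines, two points are on at most one common line, and for each point $p$ not on a line $L$ there is a unique point of $L$ collinear with $p$, denoted $\mathrm{proj}_Lp$; thick means $s,t>1$. An elation generalized quadrangle $(\mathcal{S}^x,H)$: $H\le\mathrm{Aut}(\mathcal{S})$ fixes every line through $x$ and acts sharply transitively on the points not collinear with $x$. A symmetry about $x$ is an automorphism fixing every point collinear with $x$; the EGQ is a skew translation generalized quadrangle if $H$ contains a subgroup $\mathbb{S}$ of order $t$ consisting of symmetries about $x$. Property ( * ): whenever a point $y\neq x$ collinear with $x$ is fixed by some element $h\in H$, then $h$ fixes every point of the line $xy$. *)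

(* Defs.v *)
From mathcomp Require Import all_boot all_fingroup all_solvable.
Set Implicit Arguments. Unset Strict Implicit. Unset Printing Implicit Defensive.

Section GQ.
Variables (Point Line : finType) (inc : Point -> Line -> bool).

(* p and q lie on a common line (every point is collinear with itself) *)
Definition collinear (p q : Point) : bool := [exists M, inc p M && inc q M].

(* proj_L p : the point of L collinear with p (meaningful when p is not on L) *)
Definition proj (L : Line) (p : Point) : Point :=
  odflt p [pick q | inc q L && collinear p q].

Definition is_GQ (s t : nat) : Prop :=
  [/\ forall L : Line, #|[set p | inc p L]| = s.+1,
      forall p : Point, #|[set L | inc p L]| = t.+1,
      forall (p q : Point) (L M : Line), p != q ->
        inc p L -> inc q L -> inc p M -> inc q M -> L = M
    & forall (p : Point) (L : Line), ~~ inc p L ->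
        exists! q, inc q L /\ collinear p q].

Definition thick (s t : nat) : Prop := 1 < s /\ 1 < t.
End GQ.

Section Aut.
Variables (Point Line : finType) (inc : Point -> Line -> bool).
Variables (gT : finGroupType) (toP : {action gT &-> Point}) (toL : {action gT &-> Line}).

(* H acts faithfully by automorphisms of the incidence structure, i.e. H <= Aut(S) *)
Definition acts_as_automorphisms (H : {set gT}) : Prop :=
  (forall h, h \in H -> forall p L, inc (toP p h) (toL L h) = inc p L) /\
  (forall h, h \in H -> (forall p, toP p h = p) -> (forall L, toL L h = L) -> h = 1%g).

Definition is_EGQ (x : Point) (H : {set gT}) : Prop :=
  [/\ acts_as_automorphisms H,
      forall h, h \in H -> forall L, inc x L -> toL L h = L
    & forall p q, ~~ collinear inc x p -> ~~ collinear inc x q ->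
        exists! h, h \in H /\ toP p h = q].

Definition symmetry_about (x : Point) (h : gT) : Prop :=
  forall p, collinear inc x p -> toP p h = p.

Definition is_STGQ (t : nat) (x : Point) (H SS : {set gT}) : Prop :=
  [/\ is_EGQ x H, SS \subset H, #|SS| = t
    & forall h, h \in SS -> symmetry_about x h].

Definition property_star (x : Point) (H : {set gT}) : Prop :=
  forall y, y != x -> collinear inc x y ->
  forall h, h \in H -> toP y h = y ->
  forall M, inc x M -> inc y M -> forall z, inc z M -> toP z h = z.
End Aut.

(* Main.v *)
Require Import Defs.
From mathcomp Require Import all_boot all_fingroup all_solvable.
From mathcomp Require Import all_order all_algebra all_field.
From mathcomp Require Import zify ring.
Set Implicit Arguments. Unset Strict Implicit. Unset Printing Implicit Defensive.
Import Order.TTheory GRing.Theory Num.Theory.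

(** Fix a point y not collinear with x. The stabilisers A_L of the lines L on y
  form a Kantor family in H, and by property ( * ) each A_L SS, the stabiliser of
  proj_L x, is normal in H. Three pairwise complementary normal subgroups make
  H / SS abelian. Let a be a nontrivial element of A_L.

  All of a SS is conjugate to a. The element t E - E^*, with E and E^* the sums of
  the A_L and of the A_L SS in the group ring, is t (s + t) times an idempotent,
  so its trace against g is an integer (Benson's argument); if g in a SS were not
  conjugate to a, this would give s + t | s^2. But the images of the A_L in
  H / SS form a partial spread, whence t <= s_q for every prime q | s, and
  that excludes s + t | s^2 unless s = t is even.

  H is a p-group: for primes q <> r with q | s and r | t, an element of SS of
  order r could commute with no q-element of A_L, as all of a SS has order #[a];
  its orbit under the Sylow q-subgroup of A_L would have s_q >= t elements.

  SS is central: modulo a central subgroup of order p one may assume that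
  [SS, H] has order at most p; a count gives a nontrivial a in A_L centralising
  SS, and then A_L centralises all the [a, h], that is, SS. The rest follows
  from |C_H(a)| = |H| / t = s^2. *)

(** * Arithmetic and counting *)

(** Put g = gcd(s, t), s = s' g, t = t' g; then s' + t' divides g. A prime q dividing s' + t'
    divides neither s' nor t', so s, t and g have equal q-parts, and t <= s_q forces t = g, a power
    of q. Now s' = 1 gives s = t even, while a prime r dividing s' gives t <= s_r <= s' < t. *)
Lemma sum_ndvd_square (s t : nat) :
    1 < s -> 1 < t -> (s = t -> odd s) ->
    (forall q, prime q -> q %| s -> t <= s`_q) ->
  ~~ (s + t %| s ^ 2).
Proof.
move=> s1 t1 sodd tle; apply/negP=> dv.
have dv2 : s + t %| s * t.
  by rewrite -(dvdn_addr _ dv) -mulnn -mulnDr dvdn_mull.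
have s0 : 0 < s by lia.
have t0 : 0 < t by lia.
set g := gcdn s t.
have g0 : 0 < g by rewrite gcdn_gt0 s0.
have /dvdnP[s' Ds] : g %| s := dvdn_gcdl s t.
have /dvdnP[t' Dt] : g %| t := dvdn_gcdr s t.
have s'0 : 0 < s' by move: s0; rewrite Ds muln_gt0 => /andP[].
have t'0 : 0 < t' by move: t0; rewrite Dt muln_gt0 => /andP[].
have cop : coprime s' t'.
  rewrite /coprime -(eqn_pmul2r g0) mul1n muln_gcdl -Ds -Dt; exact/eqP.
have dvg : s' + t' %| g.
  move: dv2; rewrite {1}Ds {1}Dt -mulnDl Ds Dt -/g.
  rewrite mulnA dvdn_pmul2r // mulnAC mulnC Gauss_dvdl //.
  rewrite coprimeMr !(coprime_sym (s' + t')).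
  rewrite /coprime gcdnDr gcdnDl [gcdn t' _]gcdnC.
  by rewrite -/(coprime _ _) cop.
have sum1 : 1 < s' + t' := leq_add s'0 t'0.
pose q := pdiv (s' + t').
have pq : prime q := pdiv_prime sum1.
have qg : q %| g := dvdn_trans (pdiv_dvd _) dvg.
have qs' : ~~ (q %| s').
  apply/negP=> qs; have: q %| t' by rewrite -(dvdn_addr _ qs) pdiv_dvd.
  move=> qt; have: q %| gcdn s' t' by rewrite dvdn_gcd qs qt.
  by rewrite (eqP cop) dvdn1 => /eqP q1; rewrite q1 in pq.
have qt' : ~~ (q %| t').
  apply: contra qs' => qt; by rewrite -(dvdn_addl _ qt) pdiv_dvd.
have logs : logn q s = logn q g.
  by rewrite {1}Ds lognM // lognE pq s'0 (negPf qs').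
have logt : logn q t = logn q g.
  by rewrite {1}Dt lognM // lognE pq t'0 (negPf qt').
have qs : q %| s by rewrite Ds dvdn_mull.
have Dtq : t = t`_q.
  apply/eqP; rewrite eqn_leq [t`_q <= t]dvdn_leq ?dvdn_part // andbT.
  by rewrite p_part logt -logs -p_part tle.
have tg : t = g.
  apply/eqP; rewrite eqn_leq [g <= t]dvdn_leq ?dvdn_gcdr // andbT.
  by rewrite {1}Dtq p_part logt -p_part dvdn_leq ?dvdn_part.
have t'1 : t' = 1%N by apply/eqP; rewrite -(eqn_pmul2r g0) mul1n -Dt -tg.
have [s'1 | s'1] := eqVneq s' 1%N.
  have st : s = t by rewrite Ds s'1 mul1n -tg.
  move: dvg; rewrite s'1 t'1 -tg -st dvdn2; by rewrite (sodd st).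
pose r := pdiv s'.
have pr : prime r by apply: pdiv_prime; rewrite ltn_neqAle eq_sym s'1.
have rs' : r %| s' := pdiv_dvd _.
have rq : r != q by apply: contraNneq qs' => <-.
have ts' : t <= s'.
  have rs : r %| s by rewrite Ds dvdn_mulr.
  apply: leq_trans (tle r pr rs) _.
  rewrite Ds partnM // -tg Dtq.
  have -> : (t`_q)`_r = 1%N.
    apply: part_p'nat; apply: sub_in_pnat (part_pnat q t) => i _ /=.
    by rewrite !inE => /eqP->; rewrite eq_sym.
  by rewrite muln1 dvdn_leq ?dvdn_part.
by have := dvdn_leq g0 dvg; rewrite -tg t'1 addn1 ltnNge ts'.
Qed.

(** Related pairs are counted by rows and by columns. A full row has |B| entries and any other |B| /
    p, so p times the count is |A| |B| plus (p - 1) |B| for each full row; likewise for columns. *)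
Lemma pairing_count (aT bT : finType) (A : {set aT}) (B : {set bT})
    (r : aT -> bT -> bool) (p : nat) :
    1 < p ->
    (forall a, a \in A -> ~~ [forall b in B, r a b] ->
       #|[set b in B | r a b]| * p = #|B|) ->
    (forall b, b \in B -> ~~ [forall a in A, r a b] ->
       #|[set a in A | r a b]| * p = #|A|) ->
  #|[set a in A | [forall b in B, r a b]]| * #|B|
    = #|A| * #|[set b in B | [forall a in A, r a b]]|.
Proof.
move=> p1 HA HB.
pose N := \sum_(a in A) \sum_(b in B | r a b) 1.
have gen (T U : finType) (C : {set T}) (D : {set U}) (e : T -> U -> bool) :
    (forall a, a \in C -> ~~ [forall b in D, e a b] ->
       #|[set b in D | e a b]| * p = #|D|) ->
    (\sum_(a in C) \sum_(b in D | e a b) 1) * p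
      = #|C| * #|D| + p.-1 * (#|[set a in C | [forall b in D, e a b]]| * #|D|).
  move=> HC; rewrite big_distrl /= (bigID (fun a => [forall b in D, e a b])) /=.
  rewrite (eq_bigr (fun=> #|D| + p.-1 * #|D|)); last first.
    move=> a /andP[Ca /forall_inP ea].
    rewrite (eq_bigl (mem D)); last by move=> b /=; apply: andb_idr; apply: ea.
    rewrite sum1_card; nia.
  rewrite [X in _ + X](eq_bigr (fun=> #|D|)); last first.
    move=> a /andP[Ca nea]; rewrite sum1dep_card -(HC a Ca nea).
    by congr (_ * _); apply: eq_card => b; rewrite !inE.
  rewrite big_split /= addnAC -(bigID _ _ (fun=> #|D|)) /= sum_nat_const.
  congr (_ + _); rewrite sum_nat_const -/(_ * _).
  rewrite (_ : #|[pred _ | _]| = #|[set a in C | [forall b in D, e a b]]|); last first.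
    by apply: eq_card => a; rewrite !inE.
  by rewrite mulnCA.
have E1 := gen _ _ A B r HA.
have E2 := gen _ _ B A (fun b a => r a b) HB.
have EN : \sum_(a in A) \sum_(b in B | r a b) 1 = \sum_(b in B) \sum_(a in A | r a b) 1.
  rewrite (exchange_big_dep (mem B)) /=; last by move=> a b _ /andP[].
  by apply: eq_bigr => b Bb; apply: eq_bigl => a; rewrite Bb.
rewrite EN E2 in E1; nia.
Qed.

Local Open Scope group_scope.

(** * Traces of idempotents *)

Section RationalTrace.
Local Open Scope ring_scope.

(** Each eigenvalue z of [X 1] satisfies z^(N+1) = z, so it is 0 or a root of unity. *)
Lemma trace_Aint n (X : nat -> 'M[algC]_n) N :
    (0 < N)%N -> (forall m, X m *m X 1 = X m.+1) -> X N.+1 = X 1 ->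
  \tr (X 1) \in Aint.
Proof.
move=> N0 mulX perX.
case: (posnP n) => [n0 | n_gt0].
  by rewrite /mxtrace big1 ?rpred0 // => i; have := ltn_ord i; rewrite [X in (_ < X)%N -> _]n0.
have [r Dr] := closed_field_poly_normal (char_poly (X 1)).
move: Dr; rewrite (monicP (char_poly_monic _)) scale1r => Dr.
have sz_r : size r = n.
  by have := size_char_poly (X 1); rewrite Dr size_prod_XsubC => -[].
have ->: \tr (X 1) = \sum_(z <- r) z.
  apply: oppr_inj; rewrite -(char_poly_trace _ n_gt0) Dr.
  by rewrite -[in n.-1]sz_r coefPn_prod_XsubC // sz_r -lt0n.
rewrite big_seq; apply: rpred_sum => z rz.
have: eigenvalue (X 1) z by rewrite eigenvalue_root_char Dr root_prod_XsubC.
case/eigenvalueP=> v Dv nzv.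
have powX m : v *m X m.+1 = z ^+ m.+1 *: v.
  elim: m => [|m IHm]; first by rewrite Dv expr1.
  by rewrite -mulX mulmxA IHm -scalemxAl Dv scalerA -exprSr.
have: z ^+ N.+1 *: v = z *: v by rewrite -powX perX.
move/eqP; rewrite -subr_eq0 -scalerBl scaler_eq0 (negPf nzv) orbF.
rewrite exprS -[X in _ - X]mulr1 -mulrBr mulf_eq0 => /orP[/eqP-> | zN1].
  exact: rpred0.
by apply: (@Aint_unity_root N) => //; rewrite unity_rootE -subr_eq0.
Qed.

End RationalTrace.

Section ClassSum.
Local Open Scope ring_scope.

(** In the group algebra, phi / c is an idempotent. [X m] is multiplication by it on one side
    composed with translation by [g ^+ m] on the other; the two commute. The trace of [X 1] is the
    sum over c, a rational algebraic integer. *)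
Lemma idempotent_class_sum_dvd (gT : finGroupType) (G : {group gT})
    (phi : gT -> int) (c : nat) :
    (0 < c)%N ->
    (forall w, w \in G -> \sum_(u in G) phi u * phi (u^-1 * w)%g = c%:Z * phi w) ->
  forall g, g \in G -> (c%:Z %| \sum_(a in G) phi (g ^ a)%g)%Z.
Proof.
move=> c_gt0 phi2 g Gg.
pose Q m (a b : gT) : algC := (phi (a^-1 * g ^+ m * b)%g)%:~R / c%:R.
pose X m := \matrix_(i < #|G|, j < #|G|) Q m (enum_val i) (enum_val j).
have c0 : (c%:R : algC) != 0 by rewrite pnatr_eq0 -lt0n.
have mulX m : X m *m X 1%N = X m.+1.
  apply/matrixP=> i j; rewrite !mxE.
  set a := enum_val i; set b := enum_val j.
  have Ga : a \in G by apply: enum_valP.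
  have Gb : b \in G by apply: enum_valP.
  transitivity (\sum_(d in G) Q m a d * Q 1%N d b).
    by rewrite (big_enum_val (fun d => Q m a d * Q 1%N d b)); apply: eq_bigr => k _; rewrite !mxE.
  (* Substituting d = h u turns the matrix product into the convolution in [phi2]. *)
  pose h := (g ^- m * a)%g.
  have Gh : h \in G by rewrite groupM ?groupV ?groupX.
  rewrite (reindex_inj (mulgI h)) /=.
  have Dw : (a^-1 * g ^+ m.+1 * b)%g \in G by rewrite !groupM ?groupV ?groupX.
  rewrite /Q.
  transitivity ((\sum_(u in G) phi u * phi (u^-1 * (a^-1 * g ^+ m.+1 * b))%g)%:~R / c%:R / c%:R : algC).
    rewrite rmorph_sum /= !mulr_suml; apply: eq_big => [u | u _].
      by rewrite groupMl.
    have ->: (a^-1 * g ^+ m * (h * u) = u)%g by rewrite /h !mulgA mulgK mulVg mul1g.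
    have ->: ((h * u)^-1 * g ^+ 1 * b = u^-1 * (a^-1 * g ^+ m.+1 * b))%g.
      by rewrite /h !invMg invgK expg1 expgSr !mulgA.
    by rewrite rmorphM /= mulrACA mulrA.
  by rewrite phi2 // rmorphM /= [c%:~R * _]mulrC mulfK.
have perX : X (#[g].+1) = X 1%N.
  by apply/matrixP=> i j; rewrite !mxE /Q expgS expg_order mulg1 expg1.
have trX : \tr (X 1%N) = (\sum_(a in G) phi (g ^ a)%g)%:~R / c%:R.
  rewrite /mxtrace rmorph_sum /= mulr_suml.
  rewrite (big_enum_val (fun a => (phi (g ^ a)%g)%:~R / c%:R : algC)).
  by apply: eq_bigr => i _; rewrite mxE /Q expg1 /conjg mulgA.
have: \tr (X 1%N) \is a Num.int.
  apply: Cint_rat_Aint; last exact: trace_Aint (order_gt0 g) mulX perX.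
  by rewrite trX rpred_div ?rpred_int ?rpred_nat.
rewrite trX => /intrP[m Dm]; apply/dvdzP; exists m.
apply: (@intr_inj algC); rewrite rmorphM /= -Dm.
by rewrite -[in RHS]mulrA mulVf ?mulr1.
Qed.

End ClassSum.

(** * Conjugacy classes that fill cosets of a normal subgroup *)

(** Abstracts what one member of the Kantor family satisfies, in a form that passes to quotients by
    subgroups of S normal in G. The bound on [#|S|] feeds the count in [full_classes_cent]. *)
Definition full_classes (gT : finGroupType) (G S A : {set gT}) : Prop :=
  [/\ A \subset G, abelian A, A :&: S = 1, #|S| <= #|A|
    & forall a c, a \in A^# -> c \in S -> a * c \in a ^: G].

(** The B-class of a lies in the coset a T, so its size is a power of p, at most p and not 1. *)
Lemma card_cent1_prime (gT : finGroupType) (p : nat) (T B : {group gT}) (a : gT) :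
    prime p -> #|T| = p -> p.-group B -> (forall b, b \in B -> [~ a, b] \in T) ->
    ~~ (B \subset 'C[a]) ->
  (#|'C_B[a]| * p)%N = #|B|.
Proof.
move=> pp oT pB aB ncB.
rewrite -(LagrangeI B 'C[a]) -indexgI; congr (_ * _)%N.
have le_p : #|B : 'C_B[a]| <= p.
  rewrite index_cent1 -oT -(card_lcoset T a); apply: subset_leq_card.
  apply/subsetP=> _ /imsetP[b Bb ->]; apply/lcosetP; exists [~ a, b]; first exact: aB.
  by rewrite /commg mulgA mulgV mul1g.
have : p.-nat #|B : 'C_B[a]| by apply: pnat_dvd pB; apply: dvdn_indexg.
case/p_natP=> [[|k] Dk].
  by case/negP: ncB; rewrite -indexg_eq1 -indexgI Dk.
apply/eqP; rewrite eqn_leq le_p andbT Dk -{1}[p]expn1 leq_exp2l // prime_gt1 //.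
Qed.

Lemma der1_abelian (gT : finGroupType) (G : {group gT}) :
  [~: [~: G, G], G] \subset 'C(G) -> abelian [~: G, G].
Proof.
move/commG1P=> L4.
have c1 : [~: [~: G, G], G, G] = 1 by [].
have c2 : [~: G, [~: G, G], G] = 1 by rewrite [[~: G, [~: _, _]]]commGC.
exact/commG1P/(three_subgroup c2 c1).
Qed.

(* If [al] centralises [S], then [a] in [A] fixes [[al, h]] up to conjugation by
  [[h, a]] in [S], and these commutators are all of [S]. *)
Lemma full_classes_cent (gT : finGroupType) (p : nat) (G S A T : {group gT}) :
    prime p -> p.-group G -> S <| G -> [~: G, G] = S -> abelian S ->
    #|T| = p -> T \subset S -> T \subset 'C(G) -> [~: S, G] \subset T ->
    full_classes G S A ->
  A \subset 'C(S).
Proof.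
move=> pp pG nSG derG abS oT sTS cGT cST [sAG abA tiAS leSA classA].
have sSG := normal_sub nSG.
have pA := pgroupS sAG pG.
have pS := pgroupS sSG pG.
have RA a c : a \in A -> c \in S -> [~ a, c] \in T.
  move=> Aa Sc; apply: (subsetP cST); rewrite commGC mem_commg //.
  exact: (subsetP sAG).
(* The count gives |C_A(S)| |S| = |A| |C_S(A)|. Since T <= C_S(A) and |S| <= |A|, C_A(S) is
   nontrivial. *)
have Er := @pairing_count _ _ A S (fun a c => c \in 'C[a]) p (prime_gt1 pp).
have [] := trivgPn (A :&: 'C(S)) _.
  rewrite -cardG_gt1.
  have {}Er : (#|A :&: 'C(S)| * #|S|)%N = (#|A| * #|S :&: 'C(A)|)%N.
    have <-: [set a in A | [forall c in S, c \in 'C[a]]] = A :&: 'C(S).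
      apply/setP=> a; rewrite !inE; congr (_ && _).
      apply/forall_inP/centP => [ca c Sc | ca c Sc].
        by have /cent1P/commute_sym := ca c Sc.
      exact/cent1P/commute_sym/ca.
    have <-: [set c in S | [forall a in A, c \in 'C[a]]] = S :&: 'C(A).
      apply/setP=> c; rewrite !inE; congr (_ && _).
      apply/forall_inP/centP => [ca a Aa | ca a Aa].
        by have /cent1P := ca a Aa.
      exact/cent1P/ca.
    apply: Er => [a Aa nca | c Sc nca].
      rewrite -(card_cent1_prime pp oT pS (RA a ^~ Aa)); last first.
        by apply: contra nca => /subsetP sSC; apply/forall_inP.
      by congr (#|pred_of_set _| * _)%N; apply/setP=> c; rewrite !inE.
    rewrite -(@card_cent1_prime _ p T A c) //.
    - by congr (#|pred_of_set _| * _)%N; apply/setP=> a; rewrite in_set in_setI cent1C.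
    - by move=> a Aa; rewrite -invg_comm groupV RA.
    - by apply: contra nca => /subsetP sSC; apply/forall_inP=> a Aa; rewrite cent1C sSC.
  have lep : p <= #|S :&: 'C(A)|.
    rewrite -oT subset_leq_card // subsetI sTS (subset_trans cGT) //.
    exact: centS.
  have := leq_mul leSA (leq_trans (prime_gt1 pp) lep).
  by rewrite -Er mulnC leq_pmul2r.
move=> al /setIP[Aal cal] nt_al.
apply/subsetP=> a Aa; apply/centP=> c Sc.
have /imsetP[h Gh Dh] : al * c \in al ^: G by apply: classA; rewrite // !inE nt_al.
have Ga := subsetP sAG a Aa.
have Stau : [~ h, a] \in S by rewrite -derG mem_commg.
have Dc : c = al^-1 * al ^ h by rewrite -Dh mulKg.
have ala : al ^ a = al by apply/conjg_fixP/commgP/(centsP abA).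
have alt : al ^ [~ h, a] = al by apply/conjg_fixP/commgP/(centP cal).
have ct : c ^ [~ h, a] = c by apply/conjg_fixP/commgP/(centsP abS).
apply/commute_sym/commgP/conjg_fixP.
(* Conjugate c = al^-1 al^h by a: here a fixes al, h a = a h [h, a], and [h, a] fixes both al and
   c. *)
rewrite {1}Dc conjMg conjVg ala -conjgM.
have ->: h * a = a * h * [~ h, a] by rewrite -commgC.
by rewrite conjgM [al ^ (a * h)]conjgM ala -Dh conjMg alt ct mulKg.
Qed.

Lemma full_classes_quotient (gT : finGroupType) (G S A T : {group gT}) :
    T <| G -> T \subset S -> S \subset G -> full_classes G S A ->
  full_classes (G / T) (S / T) (A / T).
Proof.
move=> nTG sTS sSG [sAG abA tiAS leSA classA].
have tiAT : T :&: A = 1.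
  by apply/trivgP; rewrite (subset_trans (setSI A sTS)) // setIC tiAS.
have nTA : A \subset 'N(T) := subset_trans sAG (normal_norm nTG).
have nTS : S \subset 'N(T) := subset_trans sSG (normal_norm nTG).
split.
- exact: quotientS.
- exact: quotient_abelian.
- by rewrite -quotientIG // tiAS quotient1.
- by rewrite -(card_isog (quotient_isog nTA tiAT)) (leq_trans (leq_morphim _ _)).
- move=> a' c' /setD1P[nt_a' /morphimP[a Na Aa Da']] /morphimP[c Nc Sc Dc'].
  have nt_a : a != 1 by apply: contraNneq nt_a' => a1; rewrite Da' a1 morph1.
  have /imsetP[h Gh Dh] : a * c \in a ^: G by apply: classA; rewrite // !inE nt_a.
  have Nh := subsetP (normal_norm nTG) h Gh.
  rewrite Da' Dc' -morphM // Dh morphJ //; apply: memJ_class.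
  exact: mem_quotient.
Qed.

(** Induction on |S|. For T of order p in S and Z(G), the case of G / T gives [S, G] <= T. Then S is
    abelian by [der1_abelian] and is centralised by A and B, which with S generate G. *)
Lemma full_classes_central (gT : finGroupType) (p : nat) (G S A B : {group gT}) :
    prime p -> p.-group G -> S <| G -> [~: G, G] = S ->
    G \subset A <*> B <*> S ->
    full_classes G S A -> full_classes G S B ->
  S \subset 'Z(G).
Proof.
move=> pp; move: {2}_.+1 (ltnSn #|S|) => n.
elim: n gT G S A B => // n IHn gT G S A B leSn pG nSG derG genG fcA fcB.
have [-> | ntS] := eqVneq (S : {set gT}) 1; first exact: sub1G.
have := meet_center_nil (pgroup_nil pG) nSG ntS => ntSZ.
have pSZ : p.-group (S :&: 'Z(G)).
  by apply: pgroupS pG; rewrite subIset // (normal_sub nSG).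
have [_ pdv _] := pgroup_pdiv pSZ ntSZ.
have [x /setIP[Sx Zx] ox] := Cauchy pp pdv.
pose T := <[x]>%G.
have sTS : T \subset S by rewrite cycle_subG.
have sTZ : T \subset 'Z(G) by rewrite cycle_subG.
have nTG : T <| G by apply: sub_center_normal.
have sSG := normal_sub nSG.
have nTS : S \subset 'N(T) := subset_trans sSG (normal_norm nTG).
have := IHn _ (G / T)%G (S / T)%G (A / T)%G (B / T)%G.
have ltST : #|S / T| < n.
  apply: leq_trans (_ : #|S| <= n) => //; apply: ltn_quotient => //.
  by rewrite -cardG_gt1 -orderE ox prime_gt1.
move/(_ ltST (quotient_pgroup _ pG) (quotient_normal _ nSG)).
rewrite /= -quotientR ?(normal_norm nTG) // derG.
move/(_ (erefl _)).
have sAG : A \subset G by case: fcA.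
have sBG : B \subset G by case: fcB.
have nTA := subset_trans sAG (normal_norm nTG).
have nTB := subset_trans sBG (normal_norm nTG).
have nTAB : A <*> B \subset 'N(T) by rewrite join_subG nTA.
rewrite -quotientY // -quotientY // quotientS //.
move/(_ isT (full_classes_quotient nTG sTS sSG fcA) (full_classes_quotient nTG sTS sSG fcB)).
rewrite subsetI => /andP[_]; rewrite quotient_cents2 ?(normal_norm nTG) // => cST.
have cGT : T \subset 'C(G) by apply: subset_trans sTZ (subsetIr _ _).
have oT : #|T| = p by rewrite -orderE.
have abS : abelian S.
  by rewrite -derG; apply: der1_abelian; rewrite derG (subset_trans cST).
have cA := full_classes_cent pp pG nSG derG abS oT sTS cGT cST fcA.
have cB := full_classes_cent pp pG nSG derG abS oT sTS cGT cST fcB.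
rewrite subsetI sSG centsC (subset_trans genG) // !join_subG cA cB; exact: abS.
Qed.

(** The group-ring product of two subgroup sums: for w in B C the contributing u form a left coset
    of the intersection. *)
Lemma convolution_groups (gT : finGroupType) (H B C : {group gT}) (w : gT) :
    B \subset H ->
  \sum_(u in H) ((u \in B) * ((u^-1 * w)%g \in C))%N
    = (#|B :&: C| * (w \in (B * C)%g))%N.
Proof.
move=> sBH.
rewrite (eq_bigr (fun u => if (u \in B) && (u^-1 * w \in C) then 1%N else 0%N)); last first.
  by move=> u _; case: (u \in B); case: (_ \in C).
rewrite -big_mkcondr sum1dep_card.
have [/mulsgP[b c Bb Cc Dw] | nBC] := boolP (w \in B * C).
  rewrite muln1 -(card_lcoset (B :&: C) b); apply: eq_card => u.
  rewrite !inE mem_lcoset inE [b^-1 * u \in B]groupMl ?groupV //.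
  rewrite andbA [(_ \in H) && _]andb_idl; last exact: (subsetP sBH).
  by rewrite Dw mulgA groupMr // -[u^-1 * b \in C]groupV invMg invgK.
rewrite muln0; apply: eq_card0 => u; rewrite !inE.
apply/negP=> /and3P[_ Bu Cw]; case/negP: nBC; apply/mulsgP.
by exists u (u^-1 * w); rewrite ?mulKVg.
Qed.

(** * Kantor families over a normal subgroup *)

Section KantorFamily.

Variables (gT : finGroupType) (I : finType) (H S : {group gT}).
Variables (D : {set I}) (A : I -> {group gT}) (s t : nat).

Hypothesis s_gt1 : 1 < s.
Hypothesis t_gt1 : 1 < t.
Hypothesis s_odd : s = t -> odd s.
Hypothesis cardD : #|D| = t.+1.
Hypothesis nSH : S <| H.
Hypothesis cardS : #|S| = t.
Hypothesis cardH : #|H| = (s ^ 2 * t)%N.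
Hypothesis sAH : forall i, i \in D -> A i \subset H.
Hypothesis cardA : forall i, i \in D -> #|A i| = s.
Hypothesis tiAS : forall i, i \in D -> A i :&: S = 1.
Hypothesis nAsH : forall i, i \in D -> A i <*> S <| H.
Hypothesis tiAAs : forall i k, i \in D -> k \in D -> i != k ->
  A i :&: A k <*> S = 1.
Hypothesis cover : forall k w, k \in D -> w \in H -> w \notin A k <*> S ->
  #|[set i in D | (i != k) && (w \in A i * A k)]| = 1%N.

Local Notation As i := (A i <*> S).

Let sSH : S \subset H := normal_sub nSH.

(** * Products, intersections and commutators of the members *)

Lemma starE i : i \in D -> As i = A i * S.
Proof.
by move=> Di; rewrite norm_joinEl // (subset_trans (sAH Di)) // normal_norm.
Qed.

Lemma star_inA i : i \in D -> A i \subset As i.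
Proof. by move=> Di; apply: joing_subl. Qed.

Lemma card_star i : i \in D -> #|As i| = (s * t)%N.
Proof. by move=> Di; rewrite starE // TI_cardMg ?tiAS // cardA // cardS. Qed.

Lemma third i j : exists2 k, k \in D & (k != i) && (k != j).
Proof.
have: 0 < #|D :\ i :\ j|.
  have := cardsD1 i D; have := cardsD1 j (D :\ i); rewrite cardD.
  by case: (i \in D); case: (j \in _); lia.
by case/card_gt0P=> k; rewrite !inE => /and3P[kj ki Dk]; exists k; rewrite // ki.
Qed.

Lemma starM i k : i \in D -> k \in D -> i != k -> A i * As k = H.
Proof.
move=> Di Dk ik; apply/eqP; rewrite eqEcard mul_subG ?sAH ?normal_sub ?nAsH //=.
by rewrite TI_cardMg ?tiAAs // cardA // card_star // cardH; lia.
Qed.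

Lemma starI i k : i \in D -> k \in D -> i != k -> As i :&: As k = S.
Proof.
move=> Di Dk ik; apply/eqP; rewrite eqEsubset subsetI !joing_subr /= andbT.
apply/subsetP=> x /setIP[]; rewrite {1}starE // => /mulsgP[a c Aa Sc ->] kx.
have Sk : c \in As k by apply: (subsetP (joing_subr _ _)).
have : a \in A i :&: As k by rewrite inE Aa -(groupMr _ Sk).
by rewrite tiAAs // => /set1P->; rewrite mul1g.
Qed.

(** Modulo S distinct A_i S commute, as their commutators lie in their intersection S. Two further
    members j and k give H = A_j A_k S, so A_i S / S is central in H / S; two such subgroups
    generate H / S. *)
Lemma der_sub : [~: H, H] \subset S.
Proof.
have nS := normal_norm nSH.
have sAsH i (Di : i \in D) : As i \subset H := normal_sub (nAsH Di).
have cc i k : i \in D -> k \in D -> i != k -> As i / S \subset 'C(As k / S).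
  move=> Di Dk ik; rewrite quotient_cents2 ?(subset_trans _ nS) ?sAsH //.
  suff: [~: As i, As k] \subset As i :&: As k by rewrite starI.
  rewrite subsetI.
  rewrite (subset_trans (commgS _ (sAsH k Dk))) ?commg_subl ?normal_norm ?nAsH //=.
  by rewrite (subset_trans (commSg _ (sAsH i Di))) ?commg_subr ?normal_norm ?nAsH.
have ccH i : i \in D -> As i / S \subset 'C(H / S).
  move=> Di; have [j Dj /andP[ji _]] := third i i.
  have [k Dk /andP[ki kj]] := third i j.
  rewrite centsC -(starM Dj Dk); last by rewrite eq_sym.
  rewrite quotientMl ?(subset_trans (sAH Dj)) // mul_subG // 1?centsC ?cc //.
  - by rewrite centsC (subset_trans (quotientS _ (star_inA Dj))) // cc.
  - by rewrite eq_sym.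
rewrite -quotient_cents2 //.
have /card_gt0P[i Di] : 0 < #|D| by rewrite cardD.
have [j Dj /andP[ji _]] := third i i.
rewrite -{1}(starM Dj Di ji) quotientMl ?(subset_trans (sAH Dj)) //.
by rewrite mul_subG ?ccH // (subset_trans (quotientS _ (star_inA Dj))) // ccH.
Qed.


Lemma memR_S g h : g \in H -> h \in H -> [~ g, h] \in S.
Proof. by move=> Hg Hh; apply: (subsetP der_sub); apply: mem_commg. Qed.

Lemma member_abelian i : i \in D -> abelian (A i).
Proof.
move=> Di; apply/commG1P/trivgP; rewrite -(tiAS Di) subsetI.
by rewrite (subset_trans _ der_sub) ?commgSS ?sAH // der1_subG.
Qed.

(** Let m = s_q. The Sylow q-subgroups of the members have t + 1 images of order m, pairwise meeting
    trivially, in the Sylow q-subgroup of H / S, of order m^2. So (t + 1)(m - 1) <= m^2 - 1. *)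
Lemma leq_part_s q : prime q -> q %| s -> t <= s`_q.
Proof.
move=> pq qs; set m := (s`_q)%N.
have m1 : 1 < m.
  rewrite /m p_part -{1}(expn0 q) ltn_exp2l ?prime_gt1 // logn_gt0 mem_primes.
  by rewrite pq qs ltnW.
have nS := normal_norm nSH.
have abHS : abelian (H / S) by rewrite sub_der1_abelian // der_sub.
pose P := 'O_q(H / S)%G.
have oP : #|P| = (m ^ 2)%N.
  rewrite (card_Hall (nilpotent_pcore_Hall q (abelian_nil abHS))).
  rewrite card_quotient // -divgS // cardH cardS mulnK ?(ltnW t_gt1) //.
  by rewrite /m -mulnn partnM ?mulnn // ltnW.
pose Y i := ('O_q(A i) / S)%G.
have oY i : i \in D -> #|Y i| = m.
  move=> Di; have nSA : 'O_q(A i) \subset 'N(S).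
    by rewrite (subset_trans (pcore_sub _ _)) // (subset_trans (sAH Di)).
  have tiS : S :&: 'O_q(A i) = 1.
    by apply/trivgP; rewrite (subset_trans (setIS S (pcore_sub _ _))) // setIC tiAS.
  rewrite -(card_isog (quotient_isog nSA tiS)).
  by rewrite (card_Hall (nilpotent_pcore_Hall q (abelian_nil (member_abelian Di)))) cardA.
have sYP i : i \in D -> Y i \subset P.
  move=> Di; rewrite pcore_max ?quotient_pgroup ?pcore_pgroup //.
  rewrite /normal quotientS ?(subset_trans (pcore_sub _ _)) ?sAH //.
  by rewrite sub_abelian_norm // quotientS // (subset_trans (pcore_sub _ _)) ?sAH.
have tiY i k : i \in D -> k \in D -> i != k -> Y i :&: Y k = 1.
  move=> Di Dk ik; apply/trivgP/subsetP=> _ /setIP[/morphimP[a Na Aa ->]].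
  case/morphimP=> b Nb Ab Eab.
  have Aia := subsetP (pcore_sub _ _) a Aa.
  have Akb := subsetP (pcore_sub _ _) b Ab.
  have: a \in A i :&: As k.
    rewrite inE Aia starE //; move/eqP: Eab.
    rewrite (sameP eqP (rcoset_kercosetP Na Nb)) => /rcosetP[c Sc ->].
    have : c * b \in As k.
      apply: groupM; [exact: (subsetP (joing_subr _ _)) | exact: (subsetP (star_inA Dk))].
    by rewrite starE.
  by rewrite tiAAs // => /set1P->; rewrite morph1 group1.
have le1 : \sum_(i in D) #|(Y i)^#| <= #|P^#|.
  rewrite -sum1_card (eq_bigr (fun i => \sum_(v in P^#) (v \in Y i)%N)); last first.
    move=> i Di; rewrite -sum1_card [RHS]big_mkcond [LHS]big_mkcond; apply: eq_bigr => v _.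
    rewrite !inE; case: (v == 1) => //=; case Yv: (v \in Y i).
      by rewrite (subsetP (sYP i Di)).
    by case: ifP.
  rewrite exchange_big /=; apply: leq_sum => v /setD1P[nt_v _].
  have [[i Di Yi] | nY] := altP (@exists_inP _ (mem D) (fun i => v \in Y i)).
    rewrite (bigD1 i) //= Yi big1 // => k /andP[Dk ki].
    apply/eqP; rewrite eqb0; apply: contra nt_v => Yk.
    by rewrite -in_set1 -[[set 1]]/(1 : {set _}) -(tiY k i) // inE Yk.
  rewrite big1 // => k Dk; apply/eqP; rewrite eqb0.
  by apply: contra nY => Yk; apply/exists_inP; exists k.
move: le1; rewrite (eq_bigr (fun=> m.-1)); last first.
  by move=> i Di; have := cardsD1 1 (Y i); rewrite oY // group1 => ->.
rewrite sum_nat_const cardD; have := cardsD1 1 P; rewrite oP group1 => E.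
by move: E m1; clear; move: m #|_| => m' n'; nia.
Qed.


(* Coefficients of [t E - E^*], one member of the family at a time. *)
Let phi_ (k : I) (w : gT) : int :=
  (t%:Z * (w \in A k)%:R - (w \in As k)%:R)%R.
Let phi (w : gT) : int := (\sum_(i in D) phi_ i w)%R.

Let convz (B C : {group gT}) w : B \subset H ->
  (\sum_(u in H) (u \in B)%:R * ((u^-1 * w)%g \in C)%:R
     = (#|B :&: C|%:R * (w \in (B * C)%g)%:R : int))%R.
Proof.
move=> sBH; rewrite -natrM -(convolution_groups C w sBH) natr_sum.
by apply: eq_bigr => u _; rewrite natrM.
Qed.

(** Four subgroup products are expanded by [convz]. For i <> k all of them except A_i A_k equal H,
    and the intersections are trivial except for A_i S and A_k S, which meet in S. *)
Lemma phi_conv i k w : i \in D -> k \in D -> w \in H ->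
  (\sum_(u in H) phi_ i u * phi_ k (u^-1 * w)%g
    = if i == k then (t * s)%:R * phi_ k w
      else t%:R ^+ 2 * (w \in (A i * A k)%g)%:R - t%:R)%R.
Proof.
move=> Di Dk Hw.
have sAsH j (Dj : j \in D) : As j \subset H := normal_sub (nAsH Dj).
transitivity (t%:R ^+ 2 * (#|A i :&: A k|%:R * (w \in (A i * A k)%g)%:R)
  - t%:R * (#|A i :&: As k|%:R * (w \in (A i * As k)%g)%:R)
  - t%:R * (#|As i :&: A k|%:R * (w \in (As i * A k)%g)%:R)
  + #|As i :&: As k|%:R * (w \in (As i * As k)%g)%:R : int)%R.
  rewrite -!convz ?sAH ?sAsH // !mulr_sumr -!sumrB -big_split /=.
  by apply: eq_bigr => u _; rewrite /phi_; ring.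
case: eqVneq => [Eik | ik].
  rewrite {i Di}Eik !setIid [A k :&: As k](setIidPl (star_inA Dk)).
  rewrite [As k :&: A k](setIidPr (star_inA Dk)) !mulGid.
  rewrite [A k * As k](mulSGid (star_inA Dk)) [As k * A k](mulGSid (star_inA Dk)).
  by rewrite cardA // card_star // /phi_ natrM; ring.
have AAs : A i * As k = H by apply: starM.
have AsA : As i * A k = H.
  by rewrite -(starM Dk Di) 1?eq_sym // [A k * _]normC // (subset_trans (sAH Dk)) // normal_norm // nAsH.
have AsAs : As i * As k = H.
  apply/eqP; rewrite eqEsubset mul_subG ?sAsH //= -{1}AAs mulSg //; exact: star_inA.
rewrite AAs AsA AsAs Hw starI // tiAAs // [As i :&: A k]setIC tiAAs // 1?eq_sym //.
have ->: A i :&: A k = 1.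
  by apply/trivgP; rewrite (subset_trans (setIS _ (star_inA Dk))) // tiAAs.
by rewrite cards1 cardS /=; ring.
Qed.

(** For fixed k the products A_i A_k with i <> k contain w exactly t times if w is in A_k, never if
    w is in A_k S only, and otherwise once by [cover]. These terms sum to t^2 [phi_ k w]; the term i
    = k adds t s [phi_ k w]. *)
Lemma phi_idem w : w \in H ->
  (\sum_(u in H) phi u * phi (u^-1 * w)%g = (t * (s + t))%N%:Z * phi w)%R.
Proof.
move=> Hw.
transitivity (\sum_(k in D) \sum_(i in D) \sum_(u in H) phi_ i u * phi_ k (u^-1 * w)%g)%R.
  symmetry; under eq_bigr => k _ do rewrite exchange_big /=.
  rewrite exchange_big /=; apply: eq_bigr => u _.
  by rewrite /phi mulr_sumr; apply: eq_bigr => k _; rewrite mulr_suml.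
rewrite /phi mulr_sumr; apply: eq_bigr => k Dk.
rewrite (bigD1 k) //= phi_conv // eqxx.
rewrite (eq_bigr (fun i => t%:R ^+ 2 * (w \in (A i * A k)%g)%:R - t%:R)%R); last first.
  by move=> i /andP[Di ik]; rewrite phi_conv // (negPf ik).
have cardDk : #|[pred i in D | i != k]| = t.
  have := cardsD1 k D; rewrite Dk cardD => -[->].
  by apply: eq_card => i; rewrite !inE andbC.
rewrite sumrB sumr_const -mulr_sumr cardDk.
have ->: (\sum_(i in D | i != k) (w \in (A i * A k)%g)%:R
   = t%:R * (w \in A k)%:R + 1 - (w \in As k)%:R :> int)%R.
  have [Aw | nAw] := boolP (w \in A k).
    rewrite (subsetP (star_inA Dk) w Aw) (eq_bigr (fun=> 1%R)).
      by rewrite sumr_const cardDk mulr1 addrK.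
    move=> i _; suff ->: w \in A i * A k by [].
    by apply/mulsgP; exists 1 w; rewrite ?mul1g.
  have [Asw | nAsw] := boolP (w \in As k).
    rewrite big1 ?mulr0 ?add0r ?subrr // => i /andP[Di ik].
    apply/eqP; rewrite pnatr_eq0 eqb0; apply: contra nAw => /mulsgP[a b Aa Ab Dw].
    have Asb := subsetP (star_inA Dk) b Ab.
    have : a \in A i :&: As k by rewrite inE Aa -(groupMr _ Asb) -Dw.
    by rewrite tiAAs // => /set1P a1; rewrite Dw a1 mul1g.
  rewrite mulr0 add0r subr0 -natr_sum.
  suff ->: (\sum_(i in D | i != k) (w \in (A i * A k)%g))%N = 1%N by [].
  rewrite -(cover Dk Hw nAsw) -sum1_card [RHS]big_mkcond [LHS]big_mkcond; apply: eq_bigr => i _.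
  by rewrite !inE; case: (i \in D); case: (i != k); case: (w \in _).
by rewrite /phi_ natrM PoszM PoszD; ring.
Qed.


(** * Conjugacy inside cosets of S *)

(** Every conjugate of g has [phi] equal to -1: member k contributes -1 and the others 0, as A_i S
    and A_k S meet in S. Hence t (s + t) divides |H| = s^2 t. *)
Lemma unconjugate_dvd k g :
    k \in D -> g \in As k -> g \notin S ->
    (forall h, h \in H -> g ^ h \notin A k) ->
  s + t %| s ^ 2.
Proof.
move=> Dk Asg nSg nAg.
have Hg : g \in H := subsetP (normal_sub (nAsH Dk)) g Asg.
have c_gt0 : 0 < t * (s + t) by rewrite muln_gt0 addn_gt0 (ltnW s_gt1) (ltnW t_gt1).
have := idempotent_class_sum_dvd c_gt0 phi_idem Hg.
rewrite (eq_bigr (fun=> (-1)%R)) => [|h Hh].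
  rewrite sumr_const cardH mulNrn dvdzE abszN natz !absz_nat.
  by rewrite mulnC dvdn_pmul2r // ltnW.
have Asgh : g ^ h \in As k.
  by rewrite memJ_norm // (subsetP (normal_norm (nAsH Dk))).
have nSgh : g ^ h \notin S by rewrite memJ_norm // (subsetP (normal_norm nSH)).
rewrite /phi (bigD1 k) //= /phi_ Asgh (negPf (nAg h Hh)) mulr0 add0r big1 ?addr0 //.
move=> i /andP[Di ik].
have nAsi : g ^ h \notin As i.
  apply: contra nSgh => Asi; rewrite -(starI Di Dk ik) inE Asi; exact: Asgh.
by rewrite (negPf nAsi) (negPf (contra (subsetP (star_inA Di) _) nAsi)) mulr0 subrr.
Qed.

(** As H / S is abelian, the two elements of A_k differ by an element of A_k and S, which is
    trivial. *)
Lemma conj_in_member k a h : k \in D -> a \in A k -> h \in H ->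
  forall c, c \in S -> (a * c) ^ h \in A k -> (a * c) ^ h = a.
Proof.
move=> Dk Aa Hh c Sc Aach.
have Ha := subsetP (sAH Dk) a Aa.
have Hc := subsetP sSH c Sc.
have: a^-1 * (a * c) ^ h \in A k :&: S.
  rewrite inE groupM ?groupV //= conjg_mulR -[a * c * _]mulgA mulKg.
  by rewrite groupM ?memR_S ?groupM.
by rewrite tiAS // => /set1P/eqP; rewrite -eq_mulVg1 => /eqP.
Qed.

Lemma member_class k a c : k \in D -> a \in (A k)^# -> c \in S ->
  a * c \in a ^: H.
Proof.
move=> Dk /setD1P[nt_a Aa] Sc.
have Asac : a * c \in As k.
  by apply: groupM; [exact: (subsetP (star_inA Dk)) | exact: (subsetP (joing_subr _ _))].
have nSac : a * c \notin S.
  apply: contra nt_a => Sac.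
  have: a \in A k :&: S by rewrite inE Aa -(groupMr _ Sc).
  by rewrite tiAS // => /set1P->.
have [/exists_inP[h Hh Aach] | nAac] := boolP [exists h in H, (a * c) ^ h \in A k].
  apply/imsetP; exists h^-1; rewrite ?groupV //.
  by rewrite -{2}(conj_in_member Dk Aa Hh Sc Aach) conjgK.
case/negP: (sum_ndvd_square s_gt1 t_gt1 s_odd leq_part_s).
apply: (unconjugate_dvd Dk Asac nSac) => h Hh.
by apply: contra nAac => Aach; apply/exists_inP; exists h.
Qed.

Lemma der_eq : [~: H, H] = S.
Proof.
apply/eqP; rewrite eqEsubset der_sub; apply/subsetP=> c Sc.
have /card_gt0P[k Dk] : 0 < #|D| by rewrite cardD.
have /trivgPn[a Aa nt_a] : A k :!=: 1 by rewrite -cardG_gt1 cardA.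
have /imsetP[h Hh Dh] : a * c \in a ^: H by apply: (@member_class k); rewrite // !inE nt_a.
have ->: c = [~ a, h] by rewrite commgEl -Dh mulKg.
by rewrite mem_commg // (subsetP (sAH Dk)).
Qed.

(** * H is a p-group with centre S *)

Lemma t_pnat q : prime q -> q %| s -> q.-nat t.
Proof.
move=> pq qs; apply/pnatP=> [|r pr rt]; first exact: ltnW.
apply: contraT; rewrite !inE => rq.
have [c Sc oc] : {c | c \in S & #[c] = r} by apply: Cauchy; rewrite // cardS.
have /card_gt0P[k Dk] : 0 < #|D| by rewrite cardD.
have nilA := abelian_nil (member_abelian Dk).
pose X := 'O_q(A k)%G.
have sXA : X \subset A k := pcore_sub _ _.
have oX : #|X| = (s`_q)%N by rewrite (card_Hall (nilpotent_pcore_Hall q nilA)) cardA.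
(* If x <> 1 in X commuted with c, then x c would have order #[x] r, yet it is conjugate to x. *)
have tiX : 'C_X[c] = 1.
  apply/trivgP/subsetP=> x /setIP[Xx /cent1P cx]; apply: contraT => nt_x.
  have Ax : x \in (A k)^# by rewrite !inE -in_set1 nt_x (subsetP sXA).
  have /imsetP[h Hh Dh] := member_class Dk Ax Sc.
  have qx : q.-elt x := mem_p_elt (pcore_pgroup _ _) Xx.
  have cop : coprime #[x] #[c].
    rewrite oc; apply: (@pnat_coprime q); first exact: qx.
    by rewrite /pnat prime_gt0 // primes_prime //= !inE andbT.
  have := orderM cx cop; rewrite Dh orderJ oc => /eqP.
  rewrite -{1}[#[x]]muln1 eqn_pmul2l ?order_gt0 // => /eqP r1.
  by rewrite -r1 in pr.
(* The orbit lies in S without 1; the trivial centraliser makes its size s_q >= t. *)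
have : #|c ^: X| < t.
  rewrite -cardS (cardsD1 1 S) group1 add1n ltnS subset_leq_card //.
  apply/subsetP=> _ /imsetP[x Xx ->]; rewrite !inE conjg_eq1 -order_eq1 oc.
  rewrite (gtn_eqF (prime_gt1 pr)) memJ_norm // (subsetP (normal_norm nSH)) //.
  by rewrite (subsetP (sAH Dk)) // (subsetP sXA).
by rewrite -index_cent1 tiX indexg1 oX ltnNge leq_part_s.
Qed.

(** As t > 1 is a power of every prime dividing s, only one prime divides s. *)
Lemma pgroupH : exists2 p, prime p & p.-group H.
Proof.
pose p := pdiv s; have pp : prime p := pdiv_prime s_gt1.
exists p => //.
have pt : p.-nat t := t_pnat pp (pdiv_dvd s).
rewrite /pgroup cardH pnatM pt andbT pnatX; apply/orP; left.
apply/pnatP=> [|r pr rs]; first exact: ltnW.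
have rt : r.-nat t := t_pnat pr rs.
apply: contraTT t_gt1; rewrite !inE => rp; rewrite -leqNgt.
have := @pnat_1 p t pt; rewrite /= => -> //.
apply: sub_in_pnat rt => i _; rewrite !inE => /eqP->; exact: rp.
Qed.

Lemma family_central : S \subset 'Z(H).
Proof.
have [p pp pH] := pgroupH.
have /card_gt0P[i Di] : 0 < #|D| by rewrite cardD.
have [j Dj /andP[ji _]] := third i i.
have leS k : k \in D -> #|S| <= #|A k|.
  move=> Dk; rewrite cardS cardA //.
  apply: leq_trans (leq_part_s (pdiv_prime s_gt1) (pdiv_dvd s)) _.
  by rewrite dvdn_leq ?dvdn_part // ltnW.
have fc k : k \in D -> full_classes H S (A k).
  move=> Dk; split; rewrite ?sAH ?member_abelian ?tiAS ?leS //.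
  by move=> a c; apply: member_class.
apply: (full_classes_central pp pH nSH der_eq _ (fc j Dj) (fc i Di)).
by rewrite -(starM Dj Di ji) -joingA mul_subG ?joing_subl ?joing_subr.
Qed.

Lemma family_card_cent k a : k \in D -> a \in (A k)^# -> #|'C_H[a]| = (s ^ 2)%N.
Proof.
move=> Dk Aa; have /setD1P[_ aA] := Aa.
have Ha := subsetP (sAH Dk) a aA.
have Dcl : a ^: H = a *: S.
  apply/setP=> b; apply/imsetP/lcosetP=> [[h Hh ->] | [c Sc ->]].
    by exists [~ a, h]; rewrite ?memR_S // -conjg_mulR.
  by have /imsetP[h Hh ->] := member_class Dk Aa Sc; exists h.
have := LagrangeI H 'C[a]; rewrite -indexgI index_cent1 Dcl card_lcoset cardS cardH.
by move=> E; apply/eqP; rewrite -(eqn_pmul2r (ltnW t_gt1)) E.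
Qed.

(** Such an a commutes with A_l, A_k and S, hence with H, but a nontrivial a has a centraliser of
    order s^2 < |H|. *)
Lemma member_cent_trivial k l a : k \in D -> l \in D -> k != l -> a \in A k ->
  A l \subset 'C[a] -> a = 1.
Proof.
move=> Dk Dl kl Aa cla; apply: contraTeq t_gt1 => nt_a.
have Aa' : a \in (A k)^# by rewrite !inE nt_a.
have : H \subset 'C[a].
  rewrite -(starM Dl Dk) 1?eq_sym // mul_subG // join_subG.
  rewrite sub_cent1 (subsetP (member_abelian Dk)) //=.
  rewrite sub_cent1 (subsetP _ a (subsetP (sAH Dk) a Aa)) // centsC.
  exact: subset_trans family_central (subsetIr _ _).
move/setIidPl=> cH; have := family_card_cent Dk Aa'; rewrite cH cardH.
move/eqP; rewrite -[X in _ == X]muln1 eqn_pmul2l ?expn_gt0 ?(ltnW s_gt1) //.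
by move/eqP->.
Qed.

(** Write z = a b c along H = A_j A_i S. Then a b is central, so the abelian A_j centralises b,
    giving b = 1; then a = 1 likewise. *)
Lemma family_center : 'Z(H) = S.
Proof.
apply/eqP; rewrite eqEsubset family_central andbT.
apply/subsetP=> z /setIP[Hz cz].
have /card_gt0P[i Di] : 0 < #|D| by rewrite cardD.
have [j Dj /andP[ji _]] := third i i.
have cS c h : c \in S -> h \in H -> commute h c.
  by move=> Sc Hh; have /setIP[_ /centP/(_ h Hh)/commute_sym] := subsetP family_central c Sc.
have Hz' := Hz; rewrite -(starM Dj Di ji) starE // mulgA in Hz'.
case/mulsgP: Hz' => ab c /mulsgP[a b Aa Ab ->] Sc Dz.
have ch h : h \in H -> commute h (a * b).
  move=> Hh; have ->: a * b = z * c^-1 by rewrite Dz mulgK.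
  apply: commuteM; first exact/commute_sym/(centP cz).
  by apply: cS; rewrite ?groupV.
have b1 : b = 1.
  apply: (member_cent_trivial Di Dj) => //; first by rewrite eq_sym.
  apply/subsetP=> h Ah; apply/cent1P.
  have ->: b = a^-1 * (a * b) by rewrite mulKg.
  apply: commuteM; last by apply/ch/(subsetP (sAH Dj)).
  by apply: commuteV; apply: (centsP (member_abelian Dj)).
have a1 : a = 1.
  apply: (member_cent_trivial Dj Di) => //.
  apply/subsetP=> h Ah; apply/cent1P.
  by have := ch h (subsetP (sAH Di) h Ah); rewrite b1 mulg1.
by rewrite Dz a1 b1 !mul1g.
Qed.

Lemma kantor_family_structure :
  [/\ 'Z(H) = S, [~: H, H] \subset S
    & forall k, k \in D ->
        abelian (A k) /\ forall a, a \in (A k)^# -> #|'C_H[a]| = (s ^ 2)%N].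
Proof.
split; [exact: family_center | exact: der_sub | move=> k Dk; split].
  exact: member_abelian.
by move=> a; apply: family_card_cent.
Qed.

End KantorFamily.

(** * Skew translation generalized quadrangles *)

Section SkewTranslationGQ.

Variables (Point Line : finType) (inc : Point -> Line -> bool) (s t : nat).
Variables (gT : finGroupType) (toP : {action gT &-> Point}) (toL : {action gT &-> Line}).
Variables (x : Point) (H SS : {group gT}).

Hypothesis gq : is_GQ inc s t.
Hypothesis th : thick s t.
Hypothesis stgq : is_STGQ inc toP toL t x H SS.
Hypothesis star : property_star inc toP x H.

Local Notation coll := (collinear inc).
Local Notation far p := (~~ coll x p).

(** * Points, lines and projections *)

Let s_gt1 : 1 < s. Proof. by case: th. Qed.
Let t_gt1 : 1 < t. Proof. by case: th. Qed.
Lemma card_line L : #|[set p | inc p L]| = s.+1. Proof. by case: gq. Qed.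
Lemma card_pencil p : #|[set L | inc p L]| = t.+1. Proof. by case: gq. Qed.

Lemma line_uniq p q L M : p != q -> inc p L -> inc q L -> inc p M -> inc q M -> L = M.
Proof. by case: gq => _ _ + _; apply. Qed.

Lemma collI p q L : inc p L -> inc q L -> coll p q.
Proof. by move=> pL qL; apply/existsP; exists L; rewrite pL qL. Qed.

Lemma collP p q : coll p q -> exists2 L, inc p L & inc q L.
Proof. by case/existsP=> L /andP[pL qL]; exists L. Qed.

Lemma coll_sym p q : coll p q = coll q p.
Proof. by apply: eq_existsb => L; rewrite andbC. Qed.

Lemma proj_uniq p L q r : ~~ inc p L ->
  inc q L -> coll p q -> inc r L -> coll p r -> q = r.
Proof.
case: gq => _ _ _ + npL qL pq rL pr => /(_ p L npL)[z [_ zu]].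
by rewrite -(zu q) // -(zu r).
Qed.

Lemma projP p L : ~~ inc p L -> inc (proj inc L p) L /\ coll p (proj inc L p).
Proof.
move=> npL; case: gq => _ _ _ /(_ p L npL)[z [[zL pz] _]].
rewrite /proj; case: pickP => [q /andP[] // | /(_ z)].
by rewrite zL pz.
Qed.

Lemma other_line p L : exists2 N, inc p N & N != L.
Proof.
have : 0 < #|[set N | inc p N] :\ L|.
  by have := cardsD1 L [set N | inc p N]; rewrite card_pencil; case: (L \in _); lia.
by case/card_gt0P=> N; rewrite !inE => /andP[NL pN]; exists N.
Qed.

Lemma other_point p L : exists2 q, inc q L & q != p.
Proof.
have : 0 < #|[set q | inc q L] :\ p|.
  by have := cardsD1 p [set q | inc q L]; rewrite card_line; case: (p \in _); lia.
by case/card_gt0P=> q; rewrite !inE => /andP[qp qL]; exists q.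
Qed.

(** * The action of the elation group *)

Lemma incJ h p L : h \in H -> inc (toP p h) (toL L h) = inc p L.
Proof. by case: stgq => -[[+ _] _ _] _ _ _ => + Hh; apply. Qed.

Lemma collJ h p q : h \in H -> coll (toP p h) (toP q h) = coll p q.
Proof.
move=> Hh; apply/idP/idP=> /collP[L pL qL].
  by apply: (@collI _ _ (toL L h^-1)); rewrite -(incJ _ _ Hh) actKV.
by apply: (@collI _ _ (toL L h)); rewrite incJ.
Qed.

Lemma pencil_fixed h L : h \in H -> inc x L -> toL L h = L.
Proof. by case: stgq => -[_ + _] _ _ _ => + Hh; apply. Qed.

Lemma base_fixed h : h \in H -> toP x h = x.
Proof.
move=> Hh; have [L xL _] : exists2 L, inc x L & true.
  have : 0 < #|[set N | inc x N]| by rewrite card_pencil.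
  by case/card_gt0P=> N; rewrite inE => xN; exists N.
have [M xM ML] := other_line x L.
apply: contraNeq ML => nxh; apply/eqP; apply: (line_uniq nxh _ xM _ xL).
  by rewrite -(pencil_fixed Hh xM) incJ.
by rewrite -(pencil_fixed Hh xL) incJ.
Qed.

Lemma farJ h p : h \in H -> far (toP p h) = far p.
Proof. by move=> Hh; rewrite -{1}(base_fixed Hh) collJ. Qed.

Lemma nincJ h L : h \in H -> inc x (toL L h) = inc x L.
Proof. by move=> Hh; rewrite -{1}(base_fixed Hh) incJ. Qed.

Lemma regular p q : far p -> far q -> exists2 h, h \in H & toP p h = q.
Proof.
move=> fp fq; case: stgq => -[_ _ /(_ p q fp fq)[h [[Hh Dh] _]]] _ _ _.
by exists h.
Qed.

Lemma semiregular p h : far p -> h \in H -> toP p h = p -> h = 1.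
Proof.
move=> fp Hh ph; case: stgq => -[_ _ /(_ p p fp fp)[k [_ ku]]] _ _ _.
by rewrite -(ku h) // (ku 1) //; split; rewrite ?act1.
Qed.

Lemma sSSH : SS \subset H. Proof. by case: stgq. Qed.
Lemma cardSS : #|SS| = t. Proof. by case: stgq. Qed.
Lemma symSS c p : c \in SS -> coll x p -> toP p c = p.
Proof. by case: stgq => _ _ _ + Sc; apply. Qed.

Lemma projL L : ~~ inc x L -> inc (proj inc L x) L. Proof. by case/projP. Qed.
Lemma projC L : ~~ inc x L -> coll x (proj inc L x). Proof. by case/projP. Qed.

Lemma proj_neq L : ~~ inc x L -> proj inc L x != x.
Proof. by move=> nxL; apply: contraNneq (nxL) => E; rewrite -{1}E projL. Qed.

Lemma far_line p L : far p -> inc p L -> ~~ inc x L.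
Proof. by move=> fp pL; apply: contra fp => xL; apply: (collI xL pL). Qed.

Lemma far_on L p : ~~ inc x L -> inc p L -> p != proj inc L x -> far p.
Proof.
move=> nxL pL; apply: contra => xp; apply/eqP.
exact: (proj_uniq nxL pL xp (projL nxL) (projC nxL)).
Qed.

Lemma far_point L : ~~ inc x L -> exists2 p, inc p L & far p.
Proof.
move=> nxL; have [p pL pz] := other_point (proj inc L x) L.
by exists p => //; apply: (far_on nxL).
Qed.

Lemma projJ h L : h \in H -> ~~ inc x L ->
  toP (proj inc L x) h = proj inc (toL L h) x.
Proof.
move=> Hh nxL; have nxLh : ~~ inc x (toL L h) by rewrite nincJ.
apply: (proj_uniq nxLh); rewrite ?projL ?projC ?incJ ?projL //.
by rewrite -{1}(base_fixed Hh) collJ ?projC.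
Qed.

(** Let z = proj_N x. Both z and its image lie on the line xz and are collinear with the image of p,
    so h fixes z. *)
Lemma line_stable h N p : h \in H -> far p -> inc p N -> inc (toP p h) N -> toL N h = N.
Proof.
move=> Hh fp pN phN.
have nxN := far_line fp pN.
set z := proj inc N x.
have [X xX zX] := collP (projC nxN).
have fph : far (toP p h) by rewrite farJ.
have npX : ~~ inc (toP p h) X by apply: contra fph => phX; apply: (collI xX phX).
have zh : toP z h = z.
  apply: (proj_uniq npX) => //.
  - by rewrite -(pencil_fixed Hh xX) incJ.
  - by rewrite collJ // (collI pN (projL nxN)).
  - exact: (collI phN (projL nxN)).
have pz : toP p h != z by apply: contraNneq fph => ->; apply: projC.
apply: (line_uniq pz); rewrite ?incJ ?projL //.
by rewrite -zh incJ // projL.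
Qed.

(** * Line stabilisers and symmetries *)

Local Notation A L := ('C_H[L | toL])%G.

Lemma memA L h : (h \in A L) = (h \in H) && (toL L h == L).
Proof. by rewrite inE; congr (_ && _); apply/astab1P/eqP. Qed.

(** By [line_stable], A L is regular on the s points of L other than proj_L x. *)
Lemma card_line_stab L : ~~ inc x L -> #|A L| = s.
Proof.
move=> nxL; have [y yL fy] := far_point nxL.
have <-: #|orbit toP (A L) y| = s.
  have := cardsD1 (proj inc L x) [set p | inc p L].
  rewrite card_line inE projL // => -[->]; apply: eq_card => p; rewrite !inE.
  apply/orbitP/andP=> [[h] | [pz pL]].
    rewrite memA => /andP[Hh /eqP hL] <-; rewrite -[in X in _ /\ is_true X]hL incJ //; split=> //.
    by apply: contraTneq (fy) => Dz; rewrite -(farJ _ Hh) Dz negbK projC.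
  have [h Hh Dh] := regular fy (far_on nxL pL pz).
  exists h => //; rewrite memA Hh; apply/eqP.
  by apply: (line_stable Hh fy yL); rewrite Dh.
rewrite card_orbit (_ : 'C_(A L)[y | toP] = 1) ?indexg1 //.
apply/trivgP/subsetP=> h /setIP[]; rewrite memA => /andP[Hh _] /astab1P hy.
by rewrite inE (semiregular fy Hh hy).
Qed.

(** Let y be a far point of L and N another line on y. Then c fixes proj_N x, and so y, the point of
    L collinear with it. *)
Lemma symmetry_stab c L : c \in H -> symmetry_about inc toP x c -> ~~ inc x L ->
  toL L c = L -> c = 1.
Proof.
move=> Hc symc nxL cL; have [y yL fy] := far_point nxL.
have [N yN NL] := other_line y L.
have nxN := far_line fy yN.
set z := proj inc N x.
have zN : inc z N by apply: projL.
have zy : z != y by apply: contraNneq fy => <-; apply: projC.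
have nzL : ~~ inc z L by apply: contra NL => zL; apply/eqP/(line_uniq zy).
apply: (semiregular fy Hc); apply: (proj_uniq nzL) => //.
- by rewrite -cL incJ.
- by rewrite -(symc z (projC nxN)) collJ // (collI zN yN).
- exact: (collI zN yN).
Qed.

(** With z = proj_L x, the SS-orbit of L has t elements by [symmetry_stab], and just t lines on z
    avoid x. *)
Lemma SS_transitive L N : ~~ inc x L -> ~~ inc x N -> inc (proj inc L x) N ->
  exists2 c, c \in SS & toL L c = N.
Proof.
move=> nxL nxN zN; set z := proj inc L x in zN.
have [X xX zX] := collP (projC nxL).
suff: N \in orbit toL SS L by case/orbitP=> c Sc Dc; exists c.
have sub : orbit toL SS L \subset [set M | inc z M] :\ X.
  apply/subsetP=> _ /orbitP[c Sc <-]; have Hc := subsetP sSSH c Sc.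
  have cz : toP z c = z := symSS Sc (projC nxL).
  rewrite !inE -{1}cz incJ // projL // andbT.
  by apply: contraNneq nxL => DX; rewrite -(nincJ _ Hc) DX.
suff /eqP->: orbit toL SS L == [set M | inc z M] :\ X.
  by rewrite !inE zN andbT; apply: contraNneq nxN => ->.
rewrite eqEcard sub card_orbit (_ : 'C_SS[L | toL] = 1).
  have := cardsD1 X [set M | inc z M]; rewrite card_pencil inE zX add1n => -[<-].
  by rewrite indexg1 cardSS leqnn.
apply/trivgP/subsetP=> c /setIP[Sc /astab1P cL].
rewrite inE; apply/eqP/(symmetry_stab (subsetP sSSH c Sc) _ nxL cL) => p.
exact: symSS.
Qed.


Lemma line_exists : exists L, ~~ inc x L.
Proof.
have : 0 < #|[set N | inc x N]| by rewrite card_pencil.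
case/card_gt0P=> X; rewrite inE => xX.
have [z zX zx] := other_point x X.
have [N zN NX] := other_line z X.
by exists N; apply: contra NX => xN; apply/eqP/(line_uniq zx).
Qed.

(** Some d in SS agrees with c on L, and c d^-1 is a symmetry fixing L. Normality of SS follows from
    this. *)
Lemma symmetry_mem c : c \in H -> symmetry_about inc toP x c -> c \in SS.
Proof.
move=> Hc symc; have [L nxL] := line_exists.
have nxLc : ~~ inc x (toL L c) by rewrite nincJ.
have zLc : inc (proj inc L x) (toL L c).
  by rewrite -(symc _ (projC nxL)) incJ // projL.
have [d Sd Dd] := SS_transitive nxL nxLc zLc.
have Hd := subsetP sSSH d Sd.
suff /eqP: c * d^-1 = 1 by rewrite -eq_mulgV1 => /eqP->.
apply: (@symmetry_stab _ L); rewrite ?groupM ?groupV //.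
  by move=> p xp; rewrite actM symc // symSS // groupV.
by rewrite actM -Dd actK.
Qed.

Lemma SS_normal : SS <| H.
Proof.
rewrite /normal sSSH; apply/normsP=> h Hh; apply/normP.
rewrite inE; apply/subsetP=> _ /imsetP[c Sc ->].
have Hc := subsetP sSSH c Sc.
apply: symmetry_mem; first by rewrite groupJ.
move=> p xp; rewrite conjgE !actM [toP _ c]symSS ?actKV //.
by rewrite -{1}(base_fixed (groupVr Hh)) collJ ?groupV.
Qed.

Lemma line_stab_ti L : ~~ inc x L -> A L :&: SS = 1.
Proof.
move=> nxL; apply/trivgP/subsetP=> c /setIP[]; rewrite memA => /andP[Hc /eqP cL] Sc.
rewrite inE; apply/eqP/(symmetry_stab Hc _ nxL cL) => p; exact: symSS.
Qed.

Lemma point_stabE L : ~~ inc x L -> 'C_H[proj inc L x | toP] = A L <*> SS.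
Proof.
move=> nxL; set z := proj inc L x; apply/eqP; rewrite eqEsubset join_subG.
apply/and3P; split.
- apply/subsetP=> h /setIP[Hh /astab1P hz].
  have nxLh : ~~ inc x (toL L h) by rewrite nincJ.
  have zLh : inc z (toL L h) by rewrite -hz incJ // projL.
  have [d Sd Dd] := SS_transitive nxL nxLh zLh.
  have Hd := subsetP sSSH d Sd.
  rewrite -[h](mulgKV d) groupM //; last exact: (subsetP (joing_subr _ _)).
  apply: (subsetP (joing_subl _ _)).
  by rewrite memA groupM ?groupV //= actM -Dd actK.
- apply/subsetP=> h; rewrite memA => /andP[Hh /eqP hL].
  by rewrite inE Hh; apply/astab1P; rewrite projJ // hL.
- rewrite subsetI sSSH; apply/subsetP=> c Sc; apply/astab1P.
  by apply: symSS; rewrite // projC.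
Qed.

Lemma star_fixes L X h p : ~~ inc x L -> inc x X -> inc (proj inc L x) X ->
  h \in A L <*> SS -> inc p X -> toP p h = p.
Proof.
move=> nxL xX zX; rewrite -point_stabE // => /setIP[Hh /astab1P hz] pX.
exact: (star (proj_neq nxL) (projC nxL) Hh hz xX zX pX).
Qed.

(** By [property_star], the stabiliser of z = proj_L x fixes the line xz pointwise, and H preserves
    that line. *)
Lemma star_normal L : ~~ inc x L -> A L <*> SS <| H.
Proof.
move=> nxL; have [X xX zX] := collP (projC nxL).
have sAsH : A L <*> SS \subset H by rewrite -point_stabE // subsetIl.
rewrite /normal sAsH; apply/normsP=> g Hg; apply/normP.
rewrite inE; apply/subsetP=> _ /imsetP[h Ash ->].
have Hh := subsetP sAsH h Ash.
rewrite -point_stabE // inE groupJ //=; apply/astab1P.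
rewrite conjgE !actM (star_fixes nxL xX zX Ash) ?actKV //.
by rewrite -(pencil_fixed (groupVr Hg) xX) incJ ?groupV.
Qed.

Lemma card_star_stab L : ~~ inc x L -> #|A L <*> SS| = (s * t)%N.
Proof.
move=> nxL; rewrite norm_joinEl; last first.
  by rewrite (subset_trans (subsetIl _ _)) // normal_norm // SS_normal.
by rewrite TI_cardMg ?line_stab_ti // card_line_stab // cardSS.
Qed.

Lemma base_line_transitive L X p : ~~ inc x L -> inc x X -> inc (proj inc L x) X ->
  inc p X -> p != x -> exists2 h, h \in H & toP (proj inc L x) h = p.
Proof.
move=> nxL xX zX pX px; have [y yL fy] := far_point nxL.
have [N pN NX] := other_line p X.
have nxN : ~~ inc x N.
  by apply: contra NX => xN; apply/eqP/(line_uniq px).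
have [q qN fq] := far_point nxN.
have [h Hh Dh] := regular fy fq; exists h => //.
have nqX : ~~ inc q X by apply: contra fq => qX; apply: (collI xX qX).
apply: (proj_uniq nqX) => //.
- by rewrite -(pencil_fixed Hh xX) incJ.
- by rewrite -Dh collJ // (collI yL (projL nxL)).
- exact: (collI qN pN).
Qed.

Lemma card_elation : #|H| = (s ^ 2 * t)%N.
Proof.
have [L nxL] := line_exists; have [X xX zX] := collP (projC nxL).
rewrite -(LagrangeI H 'C[proj inc L x | toP]) -indexgI point_stabE //.
rewrite card_star_stab // -point_stabE // -card_orbit.
suff ->: orbit toP H (proj inc L x) = [set p | inc p X] :\ x.
  have := cardsD1 x [set p | inc p X]; rewrite card_line inE xX add1n => -[<-]; lia.
apply/setP=> p; rewrite !inE; apply/orbitP/andP=> [[h Hh <-] | [px pX]].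
  rewrite -(pencil_fixed Hh xX) incJ //; split=> //.
  by rewrite projJ // proj_neq // nincJ.
exact: base_line_transitive xX zX pX px.
Qed.

(** * The Kantor family at a point not collinear with x *)

Section FarPoint.

Variable y : Point.
Hypothesis fy : far y.

Let D := [set L | inc y L].

Let nx L : L \in D -> ~~ inc x L.
Proof. by rewrite inE; apply: far_line fy. Qed.

(** Such an a fixes L and proj_N x, hence y, the point of L collinear with proj_N x. *)
Lemma line_stab_star_ti L N : L \in D -> N \in D -> L != N ->
  A L :&: A N <*> SS = 1.
Proof.
move=> yL yN LN; apply/trivgP/subsetP=> a /setIP[].
rewrite memA => /andP[Ha /eqP aL]; rewrite /= -point_stabE ?nx //.
case/setIP=> _ /astab1P; set z := proj inc N x => az.
have nxN := nx yN; have zN : inc z N := projL nxN.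
rewrite !inE in yL yN *.
have zy : z != y by apply: contraNneq fy => <-; apply: projC.
have nzL : ~~ inc z L by apply: contra LN => zL; apply/eqP/(line_uniq zy).
apply/eqP/(semiregular fy Ha); apply: (proj_uniq nzL) => //.
- by rewrite -aL incJ.
- by rewrite -az collJ // (collI zN yN).
- exact: (collI zN yN).
Qed.

(** If w = b a with b in A L and a in A N, then a takes y to the point c of N collinear with the
    image of y under w. This determines a and b, and L joins y to its image under b. *)
Lemma line_stab_cover N w : N \in D -> w \in H -> w \notin A N <*> SS ->
  #|[set L in D | (L != N) && (w \in A L * A N)]| = 1%N.
Proof.
move=> yN Hw nAsw; have nxN := nx yN; have yN' : inc y N by rewrite inE in yN.
have fyw : far (toP y w) by rewrite farJ.
have nAw : w \notin A N.
  by apply: contra nAsw; apply: (subsetP (joing_subl _ _)).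
have nywN : ~~ inc (toP y w) N.
  by apply: contra nAw => ywN; rewrite memA Hw (line_stable Hw fy yN' ywN) /=.
have [X xX zX] := collP (projC nxN).
pose c := proj inc N (toP y w).
have [cN ywc] : inc c N /\ coll (toP y w) c := projP nywN.
(* Otherwise w would fix proj_N x; now c is far, so some a in H takes y to c. *)
have cz : c != proj inc N x.
  apply: contraNneq nAsw => Dc; rewrite -point_stabE // inE Hw; apply/astab1P.
  have nywX : ~~ inc (toP y w) X by apply: contra fyw => ywX; apply: (collI xX ywX).
  apply: (proj_uniq nywX) => //.
  - by rewrite -(pencil_fixed Hw xX) incJ.
  - by rewrite collJ // (collI yN' (projL nxN)).
  - by rewrite -Dc.
have [a Ha Da] := regular fy (far_on nxN cN cz).
have Aa : a \in A N.
  by rewrite memA Ha (line_stable Ha fy yN') ?Da /=.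
pose b := w * a^-1.
have Hb : b \in H by rewrite groupM ?groupV.
have Db : toP y b = toP (toP y w) a^-1 by rewrite /b actM.
have : coll y (toP y b).
  by rewrite -(collJ _ _ Ha) Db actKV Da coll_sym.
case/collP=> L yL ybL.
have Ab : b \in A L by rewrite memA Hb (line_stable Hb fy yL ybL) /=.
have Dw : w = b * a by rewrite /b mulgKV.
have LN : L != N.
  by apply: contraNneq nAw => EL; rewrite Dw groupM // -EL.
have DL : L \in D by rewrite inE.
apply/eqP/cards1P; exists L; apply/setP=> M; rewrite [in RHS]inE [in LHS]inE.
apply/and3P/eqP=> [[DM MN /mulsgP[b' a' Ab' Aa' Dw']] | ->]; last first.
  by split=> //; apply/mulsgP; exists b a.
have Ha' : a' \in H by move: Aa'; rewrite memA => /andP[].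
have Hb' : b' \in H by move: Ab'; rewrite memA => /andP[].
have yM : inc y M by rewrite inE in DM.
have Eaa : toP y a' = toP y a.
  rewrite Da; apply: (proj_uniq nywN) => //.
    by move: Aa'; rewrite memA => /andP[_ /eqP <-]; rewrite incJ.
  rewrite Dw' actM collJ // coll_sym; apply: (collI yM).
  by move: Ab'; rewrite memA => /andP[_ /eqP <-]; rewrite incJ.
have Ea : a' = a.
  apply/eqP; rewrite eq_mulgV1; apply/eqP/(semiregular fy); rewrite ?groupM ?groupV //.
  by rewrite actM Eaa actK.
have Eb : b' = b by rewrite /b Dw' Ea mulgK.
apply: contraNeq nAw => ML.
have : b \in A M :&: A L <*> SS.
  by rewrite inE -{1}Eb Ab' (subsetP (joing_subl _ _)).
by rewrite line_stab_star_ti // => /set1P b1; rewrite Dw b1 mul1g.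
Qed.

End FarPoint.

(** * Lines fixed by an element of a line stabiliser *)

Hypothesis s_odd : s = t -> odd s.

Lemma elation_structure y : far y ->
  [/\ 'Z(H) = SS, [~: H, H] \subset SS
    & forall L, inc y L ->
        abelian (A L) /\ forall a, a \in (A L)^# -> #|'C_H[a]| = (s ^ 2)%N].
Proof.
move=> fy.
have nx N : N \in [set N | inc y N] -> ~~ inc x N by rewrite inE; apply: far_line fy.
have [] := @kantor_family_structure _ _ H SS [set N | inc y N] (fun N => A N) s t => //.
- exact: card_pencil.
- exact: SS_normal.
- exact: cardSS.
- exact: card_elation.
- by move=> N _; apply: subsetIl.
- by move=> N /nx; apply: card_line_stab.
- by move=> N /nx; apply: line_stab_ti.
- by move=> N /nx; apply: star_normal.
- exact: line_stab_star_ti.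
- exact: line_stab_cover.
- by move=> ZH dH hL; split=> // L yL; apply: hL; rewrite inE.
Qed.

Lemma elation_center : 'Z(H) = SS.
Proof.
have [L nxL] := line_exists; have [y _ fy] := far_point nxL.
by case: (elation_structure fy).
Qed.

Lemma elation_der : [~: H, H] \subset SS.
Proof.
have [L nxL] := line_exists; have [y _ fy] := far_point nxL.
by case: (elation_structure fy).
Qed.

Lemma line_stab_abelian L : ~~ inc x L -> abelian (A L).
Proof.
move=> nxL; have [y yL fy] := far_point nxL.
by case: (elation_structure fy) => _ _ /(_ L yL)[].
Qed.

Lemma card_cent_line_stab L a : ~~ inc x L -> a \in (A L)^# ->
  #|'C_H[a]| = (s ^ 2)%N.
Proof.
move=> nxL; have [y yL fy] := far_point nxL.
by case: (elation_structure fy) => _ _ /(_ L yL)[_]; apply.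
Qed.

Lemma SS_commute c h : c \in SS -> h \in H -> commute c h.
Proof. by rewrite -elation_center => /setIP[_ /centP cc] Hh; apply: cc. Qed.

(** A line N on proj_L x but not on x is the image of L under some c in SS, and c commutes with
    h. *)
Lemma line_stab_fixes_pencil L h N : ~~ inc x L -> h \in H -> toL L h = L ->
  inc (proj inc L x) N -> toL N h = N.
Proof.
move=> nxL Hh hL zN.
have [xN | nxN] := boolP (inc x N); first exact: pencil_fixed.
have [c Sc <-] := SS_transitive nxL nxN zN.
by rewrite -actM (SS_commute Sc Hh) actM hL.
Qed.

(** If a fixes the image of L under g, then a and its conjugate by g^-1 both lie in A L and differ
    by a commutator, an element of SS. *)
Lemma fixed_line_conj L a g : ~~ inc x L -> a \in A L -> g \in H ->
  (toL (toL L g) a == toL L g) = (g \in 'C[a]).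
Proof.
move=> nxL Aa Hg; have := Aa; rewrite memA => /andP[Ha /eqP aL].
apply/eqP/cent1P => [agL | ag]; last by rewrite -actM ag actM aL.
have Aag : a ^ g^-1 \in A L.
  by rewrite memA groupJ ?groupV //= conjgE invgK !actM agL actK.
have : a^-1 * a ^ g^-1 \in A L :&: SS.
  rewrite inE groupM ?groupV // -/([~ a, g^-1]) (subsetP elation_der) //.
  by rewrite mem_commg ?groupV.
rewrite line_stab_ti // => /set1P/eqP; rewrite -eq_mulVg1 => /eqP E.
apply/commute_sym/commgP/conjg_fixP; by rewrite -{2}(conjgKV g a) -E.
Qed.

Lemma fixed_points_orbit L X a : ~~ inc x L -> a \in A L ->
    inc x X -> inc (proj inc L x) X ->
  [set z | inc z X && [exists N, [&& ~~ inc x N, toL N a == N & inc z N]]]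
    = orbit toP 'C_H[a] (proj inc L x).
Proof.
move=> nxL Aa xX zX; apply/setP=> p; rewrite inE.
apply/andP/orbitP=> [[pX /existsP[N /and3P[nxN aN pN]]] | [g /setIP[Hg ag] <-]].
  have px : p != x by apply: contraNneq nxN => <-.
  have [g Hg Dg] := base_line_transitive nxL xX zX pX px.
  have nxNg : ~~ inc x (toL N g^-1) by rewrite nincJ ?groupV.
  have zNg : inc (proj inc L x) (toL N g^-1) by rewrite -(incJ _ _ Hg) Dg actKV.
  (* The factor c fixes proj_L x and makes c g carry L to N, so c g centralises a. *)
  have [c Sc Dc] := SS_transitive nxL nxNg zNg.
  have Hc := subsetP sSSH c Sc.
  exists (c * g); last by rewrite actM (symSS Sc) ?projC.
  rewrite inE groupM // -(fixed_line_conj nxL Aa) ?groupM //.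
  by rewrite actM Dc actKV.
split; first by rewrite -(pencil_fixed Hg xX) incJ.
apply/existsP; exists (toL L g); rewrite nincJ // nxL incJ // projL // andbT.
by rewrite fixed_line_conj.
Qed.

(** The set is an orbit of C_H(a), of order s^2, with point stabiliser A L SS, of order s t. *)
Lemma card_fixed_points L a X : ~~ inc x L -> a \in (A L)^# ->
    inc x X -> inc (proj inc L x) X ->
  (#|[set z | inc z X && [exists N, [&& ~~ inc x N, toL N a == N & inc z N]]]| * t)%N = s.
Proof.
move=> nxL Aa xX zX; have /setD1P[nt_a aA] := Aa.
rewrite (fixed_points_orbit nxL aA xX zX) card_orbit.
have EC : 'C_('C_H[a])[proj inc L x | toP] = A L <*> SS.
  rewrite setIAC point_stabE //; apply/setIidPl.
  rewrite join_subG sub_cent1 (subsetP (line_stab_abelian nxL)) //=.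
  apply/subsetP=> c Sc; apply/cent1P; apply: SS_commute => //.
  by move: aA; rewrite memA => /andP[].
have := Lagrange (subsetIl 'C_H[a] 'C[proj inc L x | toP]).
rewrite /= EC card_star_stab // (card_cent_line_stab nxL Aa).
have := s_gt1; move: #|_ : _| => n; nia.
Qed.

(** Otherwise a fixes pointwise another line Y on x, by [property_star]. For y a far point of L, a
    fixes q = proj_Y y and so lies in A M SS, where M = yq differs from L; this forces a = 1. *)
Lemma fixed_line_meets L N a X : ~~ inc x L -> a \in (A L)^# ->
    inc x X -> inc (proj inc L x) X -> ~~ inc x N -> toL N a = N ->
  inc (proj inc N x) X.
Proof.
move=> nxL /setD1P[nt_a aA] xX zX nxN aN.
have [y yL fy] := far_point nxL.
have [Y xY zY] := collP (projC nxN).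
have [<- // | YX] := eqVneq Y X.
have := aA; rewrite memA => /andP[Ha _].
have nyY : ~~ inc y Y by apply: contra fy => yY; apply: (collI xY yY).
have [qY yq] := projP nyY; set q := proj inc Y y in qY yq.
have [M yM qM] := collP yq.
have nxM := far_line fy yM.
have Dq : q = proj inc M x.
  exact: (proj_uniq nxM qM (collI xY qY) (projL nxM) (projC nxM)).
have AsN : a \in A N <*> SS.
  by apply: (subsetP (joing_subl _ _)); rewrite memA Ha aN eqxx.
have AsM : a \in A M <*> SS.
  rewrite -point_stabE // inE Ha; apply/astab1P.
  by rewrite -Dq (star_fixes nxN xY zY AsN).
have LM : L != M.
  apply: contraNneq YX => LM; apply/eqP; apply: (@line_uniq x (proj inc L x)) => //.
    by rewrite eq_sym proj_neq.
  by rewrite LM -Dq.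
have : a \in A L :&: A M <*> SS by rewrite inE aA.
have [DL DM] : L \in [set K | inc y K] /\ M \in [set K | inc y K] by rewrite !inE.
by rewrite (line_stab_star_ti fy DL DM LM) => /set1P a1; rewrite a1 eqxx in nt_a.
Qed.

End SkewTranslationGQ.

Close Scope group_scope.

Theorem mainTheorem6 (Point Line : finType) (inc : Point -> Line -> bool)
  (s t : nat) (gT : finGroupType)
  (toP : {action gT &-> Point}) (toL : {action gT &-> Line})
  (x : Point) (H SS : {group gT}) :
  is_GQ inc s t -> thick s t -> (s = t -> odd s) ->
  is_STGQ inc toP toL t x H SS ->
  property_star inc toP x H ->
  (* (i) *)
  (forall L, ~~ inc x L -> forall h, h \in H -> toL L h = L ->
     forall N, inc (proj inc L x) N -> toL N h = N) /\
  (* (ii) *)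
  (forall L, ~~ inc x L -> forall a, a \in H -> toL L a = L -> a != 1%g ->
     forall M, inc x M -> inc (proj inc L x) M ->
       #|[set z | inc z M &&
                  [exists N, [&& ~~ inc x N, toL N a == N & inc z N]]]| * t = s
       /\ (s = t -> forall N,
             (~~ inc x N && (toL N a == N)) = (inc (proj inc L x) N && (N != M)))) /\
  (* (iii) *)
  ('Z(H))%g = SS :> {set gT}.
Proof.
move=> gq th sodd stgq star; split; [|split].
- by move=> L nxL h Hh hL N zN; apply: (line_stab_fixes_pencil gq th stgq star sodd nxL).
- move=> L nxL a Ha aL nt_a M xM zM.
  have Aa : a \in ('C_H[L | toL]^#)%g.
    by rewrite in_setD1 nt_a in_setI Ha; apply/astab1P.
  have cardB := card_fixed_points gq th stgq star sodd nxL Aa xM zM.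
  split=> // st N; apply/andP/andP=> [[nxN /eqP aN] | [zN NM]].
    have zN := projL gq nxN; have zNM := fixed_line_meets gq th stgq star nxL Aa xM zM nxN aN.
    split; last by apply: contraNneq nxN => ->.
    (* For s = t the set has a single element, so proj_N x = proj_L x. *)
    move: cardB; set B := [set z | _] => /eqP; rewrite st -[X in _ == X]mul1n.
    rewrite eqn_pmul2r; last by case: th => _ /ltnW.
    case/cards1P=> b DB.
    have /set1P EN : proj inc N x \in [set b].
      rewrite -DB inE zNM; apply/existsP; exists N; rewrite nxN aN eqxx; exact: zN.
    have /set1P EL : proj inc L x \in [set b]; last by rewrite EL -EN.
    rewrite -DB inE zM; apply/existsP; exists L; rewrite nxL aL eqxx; exact: (projL gq).
  split; last by rewrite (line_stab_fixes_pencil gq th stgq star sodd nxL).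
  apply: contra NM => xN; apply/eqP.
  by apply: (line_uniq gq (proj_neq gq nxL)).
- exact: elation_center gq th stgq star sodd.
Qed.
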